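(* Let $m,s\in\mathbb N$ and let $\mathcal F$ be an $m$-block Ferrers diagram of order $sm$. If $\mathcal F$ is strictly $m$-monotone (or initially $m$-convex), then for any $2\le d\le sm$ the pair $(\mathcal F,d)$ is MSRD-constructible. In particular, $(\mathcal T_{s,m}^B,d)$ is MSRD-constructible for every $d\in[sm]$.
   Context: Notation: $\mathbb N=\{1,2,\dots\}$ and $[n]=\{1,\dots,n\}$, $[0]=\emptyset$. A (top-right justified) Ferrers diagram of order $n$ is a subset $\mathcal F\subseteq[n]^2$ such that (1) $(i,j)\in\mathcal F$ and $j<n$ imply $(i,j+1)\in\mathcal F$; (2) $(i,j)\in\mathcal F$ and $i>1$ imply $(i-1,j)\in\mathcal F$. Write $\mathcal F=[c_1,\dots,c_n]$ where $c_j$ is the number of elements of $\mathcal F$ in column $j$. For $d\in[n]$ and $j\in\{0,\dots,d-1\}$ let $\nu_j(\mathcal F,d)=\sum_{i=1}^{n-j}\max\{0,c_i-d+1+j\}$ and $\nu_{\min}(\mathcal F,d)=\min_{0\le j\le d-1}\nu_j(\mathcal F,d)$. A Ferrers diagram $[c_1,\dots,c_n]$ is strictly monotone if, whenever $i\in[n-1]$ and $c_i>0$, one has $c_{i+1}>c_i$. It is convex if $c_{i+1}-c_i\le1$ for every $i\in[n-1]$, and initially convex if it is convex and $c_1\le1$. Blocks: $Q_{i,j}=Q_{i,j}^{(m)}:=([im]\setminus[(i-1)m])\times([jm]\setminus[(j-1)m])$. A Ferrers diagram $\mathcal F$ of order $sm$ is an $m$-block Ferrers diagram if $Q_{i,j}\cap\mathcal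 F\in\{\emptyset,Q_{i,j}\}$ for all $i,j\in[s]$; its block set is $\mathbf B(\mathcal F)=\{Q_{i,j}: i,j\in[s],\ Q_{i,j}\subseteq\mathcal F\}$. Its contraction is the Ferrers diagram $\{(i,j)\in[s]^2:Q_{i,j}\subseteq\mathcal F\}$ of order $s$. $\mathcal F$ is strictly $m$-monotone (resp. initially $m$-convex) if its contraction is strictly monotone (resp. initially convex). Block diagonals: $D_i^B=\{Q_{l,s-i+l}:1\le l\le i\}$, $i\in[s]$. The pair $(\mathcal F,d)$, $d\in[sm]$, is MSRD-constructible if $\nu_{\min}(\mathcal F,d)=m\sum_{i=1}^s\max\{m|D_i^B\cap\mathbf B(\mathcal F)|-d+1,0\}$. The block triangular diagram is $\mathcal T_{s,m}^B=\bigcup_{1\le i\le j\le s}Q_{i,j}^{(m)}$. *)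

(* Defs.v *)
From mathcomp Require Import all_boot.

Set Implicit Arguments.
Unset Strict Implicit.
Unset Printing Implicit Defensive.

(* A cell (i, j) is (row, column). Rows, columns and block indices are counted
   from 0, so the element k of [n] is the element k - 1 of 'I_n. *)
Notation diagram n := {set 'I_n * 'I_n}.

Section Ferrers.

Variables (n : nat) (F : diagram n).

Definition is_ferrers : Prop :=
  (forall i j j' : 'I_n, j' = j.+1 :> nat -> (i, j) \in F -> (i, j') \in F) /\
  (forall i i' j : 'I_n, i = i'.+1 :> nat -> (i, j) \in F -> (i', j) \in F).

Definition colsize (j : 'I_n) : nat := #|[set i | (i, j) \in F]|.

(* Truncated subtraction: c + j.+1 - d is max{0, c - d + 1 + j}. *)
Definition nu (d j : nat) : nat :=
  \sum_(i < n | i < n - j) (colsize i + j.+1 - d).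

(* Starting the minimum at nu d 0 changes nothing when 0 < d. *)
Definition nu_min (d : nat) : nat := \big[minn/nu d 0]_(j < d) nu d j.

Definition strictly_monotone : Prop :=
  forall i i' : 'I_n, i' = i.+1 :> nat ->
    0 < colsize i -> colsize i < colsize i'.

Definition convex : Prop :=
  forall i i' : 'I_n, i' = i.+1 :> nat -> colsize i' <= colsize i + 1.

Definition initially_convex : Prop :=
  convex /\ (forall i : 'I_n, i = 0 :> nat -> colsize i <= 1).

End Ferrers.

Section Block.

Variables m s : nat.

Definition block (i j : nat) : diagram (s * m) :=
  setX [set x : 'I_(s * m) | i * m <= x < i.+1 * m]
       [set y : 'I_(s * m) | j * m <= y < j.+1 * m].

Definition is_block_ferrers (F : diagram (s * m)) : Prop :=
  is_ferrers F /\
  forall i j : 'I_s, block i j :&: F = set0 \/ block i j :&: F = block i j.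

Definition block_set (F : diagram (s * m)) : {set diagram (s * m)} :=
  [set block p.1 p.2 | p : 'I_s * 'I_s & block p.1 p.2 \subset F].

Definition contraction (F : diagram (s * m)) : diagram s :=
  [set p : 'I_s * 'I_s | block p.1 p.2 \subset F].

Definition strictly_block_monotone (F : diagram (s * m)) : Prop :=
  strictly_monotone (contraction F).

Definition initially_block_convex (F : diagram (s * m)) : Prop :=
  initially_convex (contraction F).

(* Here 1 <= i <= s, as for D_i^B, while l runs from 0 to i - 1. *)
Definition block_diag (i : nat) : {set diagram (s * m)} :=
  [set block l (s - i + l) | l : 'I_i].

(* The subtraction is truncated, which gives max{m |D_i^B :&: B(F)| - d + 1, 0}. *)
Definition MSRD_constructible (F : diagram (s * m)) (d : nat) : Prop :=
  nu_min F d =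
  m * \sum_(1 <= i < s.+1) (m * #|block_diag i :&: block_set F| + 1 - d).

Definition block_triangular : diagram (s * m) :=
  \bigcup_(i < s) \bigcup_(j < s | i <= j) block i j.

Lemma in_block i j (p : 'I_(s * m) * 'I_(s * m)) : 0 < m ->
  (p \in block i j) = (p.1 %/ m == i) && (p.2 %/ m == j).
Proof.
move=> m0; have E k (x : nat) : (k * m <= x < k.+1 * m) = (x %/ m == k).
  by rewrite -leq_divRL // -ltn_divLR // ltnS andbC -eqn_leq.
by case: p => x y; rewrite in_setX !inE !E.
Qed.

Lemma in_block_triangular (p : 'I_(s * m) * 'I_(s * m)) : 0 < m ->
  (p \in block_triangular) = (p.1 %/ m <= p.2 %/ m).
Proof.
move=> m0; have lt (x : 'I_(s * m)) : x %/ m < s by rewrite ltn_divLR.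
apply/bigcupP/idP => [[i _ /bigcupP[j le_ij]]|le].
  by rewrite in_block // => /andP[/eqP -> /eqP ->].
exists (Ordinal (lt p.1)) => //; apply/bigcupP.
by exists (Ordinal (lt p.2)) => //; rewrite in_block // !eqxx.
Qed.

Lemma block_triangular_is_block_ferrers :
  0 < m -> is_block_ferrers block_triangular.
Proof.
move=> m0; split; first split.
- move=> i j j' e; rewrite !in_block_triangular //= => le.
  by apply: (leq_trans le); rewrite e leq_div2r.
- move=> i i' j e; rewrite !in_block_triangular //=.
  by apply: leq_trans; rewrite e leq_div2r.
move=> i j; case: (leqP i j) => ij; [right | left]; apply/setP => p;
  rewrite in_setI ?in_set0 in_block // in_block_triangular //;
  by case: eqP => //= ->; case: eqP => //= ->; rewrite ?ij // leqNgt ij.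
Qed.

Lemma contraction_is_ferrers (F : diagram (s * m)) :
  0 < m -> is_block_ferrers F -> is_ferrers (contraction F).
Proof.
move=> m0 [[hR hU] hB].
have lt (k : 'I_s) : k * m < s * m by rewrite ltn_pmul2r.
have right k (i j j' : 'I_(s * m)) : j' = j + k :> nat -> (i, j) \in F -> (i, j') \in F.
  elim: k j' => [|k IH] j' e ij.
    by have -> : j' = j by apply/val_inj; rewrite /= e addn0.
  have h : j + k < s * m by apply: ltn_trans (ltn_ord j'); rewrite e addnS.
  by apply: (hR i (Ordinal h)); [rewrite e addnS | apply: IH].
have up k (i i' j : 'I_(s * m)) : i = i' + k :> nat -> (i, j) \in F -> (i', j) \in F.
  elim: k i' => [|k IH] i' e ij.
    by have <- : i = i' by apply/val_inj; rewrite /= e addn0.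
  have h : i'.+1 < s * m by apply: leq_ltn_trans (ltn_ord i); rewrite e addnS ltnS leq_addr.
  by apply: (hU (Ordinal h)) => //; apply: IH; rewrite //= e addnS addSn.
have full (i j : 'I_s) : (block i j \subset F) = ((Ordinal (lt i), Ordinal (lt j)) \in F).
  have cB : (Ordinal (lt i), Ordinal (lt j)) \in block i j by rewrite in_block //= !mulnK // !eqxx.
  apply/idP/idP => [/subsetP|cF]; first exact.
  case: (hB i j) => [/setP/(_ (Ordinal (lt i), Ordinal (lt j)))|<-]; last exact: subsetIr.
  by rewrite in_setI in_set0 cB cF.
split=> [i j j' e | i i' j e]; rewrite !in_set /= !full.
  by apply: (right m); rewrite /= e mulSn addnC.
by apply: (up m); rewrite /= e mulSn addnC.
Qed.

End Block.

(* Main.v *)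
Require Import Defs.
From mathcomp Require Import all_boot zify.

Set Implicit Arguments.
Unset Strict Implicit.
Unset Printing Implicit Defensive.

(** The number nu_j counts the cells of the diagram that survive when its top
    d - 1 - j rows and its last j columns are deleted, that is, d - 1 lines in
    all.  On a block diagonal with delta blocks in the diagram, each row and each
    column meets at most m cells, so at least m (m delta - (d - 1)) of its
    m^2 delta cells survive ([diagonal_bound]).  Summing over the block diagonals
    gives the lower bound nu_min >= m sum_i max(m delta_i - d + 1, 0) ([nu_ge]),
    for every block Ferrers diagram.

    The bound is attained by some j as soon as no block of the diagram lies
    below the main diagonal and, on each block diagonal, either every deleted
    line removes m cells that no other one removes, or nothing survives. If the
    contraction is initially convex, the column heights grow by at most 1, so
    the blocks of the diagram on a diagonal are its first ones, and deleting
    rows only (j = 0) is optimal ([diagonal_initial], [nu_first_min]). If it is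
    strictly monotone, the heights grow by at least 1, the blocks on a diagonal
    are its last ones, and deleting columns only (j = d - 1) is optimal
    ([diagonal_final], [nu_last_min]). The block triangular diagram is strictly
    monotone.

    Everything is computed blockwise: a block keeping x rows and y columns keeps
    x * y cells, and these products are summed along diagonals. *)

(** * Finite sums and minima *)

Lemma bigmin_leq (I : eqType) (r : seq I) x (f : I -> nat) i :
  i \in r -> \big[minn/x]_(k <- r) f k <= f i.
Proof.
elim: r => // k r IH; rewrite inE big_cons => /orP[/eqP -> | /IH le].
  exact: geq_minl.
by rewrite geq_min le orbT.
Qed.

(** A triangle summed by columns or by diagonals: the diagonal of length i.+1
    consists of the cells (l, s.-1 - i + l) with l <= i. *)
Lemma sum_triangle s (G : nat -> nat -> nat) :
  \sum_(b < s) \sum_(l < b.+1) G l b =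
  \sum_(i < s) \sum_(l < i.+1) G l (s.-1 - i + l).
Proof.
elim: s => [|s IH]; first by rewrite !big_ord0.
rewrite big_ord_recr {}IH /=.
under [in RHS]eq_bigr => i _ do
  rewrite big_ord_recr /= (subnK (leq_ord i)).
rewrite big_split /= [X in _ = X + _]big_ord_recl big_ord0 add0n; congr (_ + _).
apply: eq_bigr => i _; apply: eq_bigr => l _; congr (G _ _).
by rewrite -subn1 -subnDA.
Qed.

(** Among the indices below k, a downward closed predicate selects an initial
    segment, whose length is the number of selected indices. *)
Lemma sum_initial k (P : pred nat) (f : nat -> nat) :
  (forall l, l.+1 < k -> P l.+1 -> P l) ->
  \sum_(l < k | P l) f l = \sum_(l < \sum_(l < k | P l) 1) f l.
Proof.
elim: k => [|k IH] down; first by rewrite !big_ord0.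
have [Pk | nPk] := boolP (P k); last first.
  rewrite !(big_mkcond (fun l : 'I__ => P l)) !big_ord_recr /= (negbTE nPk) !addn0.
  by rewrite -!big_mkcond; apply: IH => l lk; apply: down; apply: ltnW.
have all_P j : j <= k -> P (k - j).
  elim: j => [|j IHj] jk; first by rewrite subn0.
  by apply: down; rewrite ?subnSK ?IHj ?(ltnW jk) // ltnS leq_subr.
have true_P (l : 'I_k.+1) : P l by rewrite -(subKn (leq_ord l)) all_P ?leq_subr.
have -> : \sum_(l < k.+1 | P l) 1 = k.+1.
  by rewrite (eq_bigl xpredT) // sum1_card card_ord.
exact: eq_bigl.
Qed.

Lemma sum_rev k (P : pred nat) (f : nat -> nat) :
  \sum_(l < k | P l) f l = \sum_(l < k | P (k.-1 - l)) f (k.-1 - l).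
Proof.
rewrite (reindex_inj rev_ord_inj).
have E (l : 'I_k) : rev_ord l = k.-1 - l :> nat by rewrite /=; lia.
by apply: eq_big => l; rewrite E.
Qed.

Lemma sum_ord_lt n k : \sum_(i < n | i < k) 1 = minn n k.
Proof.
elim: n => [|n IH]; first by rewrite big_ord0 min0n.
by rewrite big_mkcond big_ord_recr -big_mkcond /= IH; case: ifP; lia.
Qed.

(** * Cells of a block diagonal left after deleting lines *)

(** Among the m rows of the l-th block row, the number of those that remain when
    the top u rows are deleted; read from the right, it counts columns as well. *)
Definition surviving m u l := l.+1 * m - u - (l * m - u).

Lemma sum_surviving m u k : \sum_(l < k) surviving m u l = k * m - u.
Proof.
elim: k => [|k IH]; first by rewrite big_ord0.
by rewrite big_ord_recr {}IH /= subnKC // leq_sub2r // leq_mul2r leqnSn orbT.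
Qed.

Lemma surviving0 m l : surviving m 0 l = m.
Proof. by rewrite /surviving !subn0 mulSn addnK. Qed.

Lemma surviving_le m u l : surviving m u l <= m.
Proof. by rewrite /surviving mulSn; lia. Qed.

(** Each deleted line lies in a single block line, so any selection of block
    lines loses at most u of them. *)
Lemma sum_lost_le m u k (P : pred nat) :
  \sum_(l < k | P l) (m - surviving m u l) <= u.
Proof.
apply: (@leq_trans (\sum_(l < k) (m - surviving m u l))).
  by rewrite big_mkcond leq_sum // => l _; case: ifP.
rewrite sumnB; last by move=> l _; apply: surviving_le.
by rewrite sum_surviving sum_nat_const card_ord leq_subLR; lia.
Qed.

(** P selects the blocks of the diagonal of length k that lie in the diagram; the
    l-th one is in block row l and in the (k.-1 - l)-th block column from the
    right.  A block keeping x of its m rows and y of its m columns keeps at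
    least m^2 - m (m - x) - m (m - y) cells, and the losses m - x, m - y add up
    to at most u and j. *)
Lemma diagonal_bound m u j k (P : pred nat) :
  m * (m * \sum_(l < k | P l) 1 - (u + j)) <=
  \sum_(l < k | P l) surviving m u l * surviving m j (k.-1 - l).
Proof.
have lost_u := sum_lost_le m u k P.
have lost_j : \sum_(l < k | P l) (m - surviving m j (k.-1 - l)) <= j.
  apply: leq_trans (sum_lost_le m j k (fun l => P (k.-1 - l))).
  rewrite [leqLHS](sum_rev k P (fun l => m - surviving m j (k.-1 - l))).
  by apply: eq_leq; apply: eq_bigr => l _; rewrite subKn //; have := ltn_ord l; lia.
have : \sum_(l < k | P l) m * m <=
    \sum_(l < k | P l) surviving m u l * surviving m j (k.-1 - l) +
    m * (\sum_(l < k | P l) (m - surviving m u l) +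
         \sum_(l < k | P l) (m - surviving m j (k.-1 - l))).
  rewrite mulnDr !big_distrr -!big_split /=; apply: leq_sum => l _.
  have := surviving_le m u l; have := surviving_le m j (k.-1 - l).
  move: (surviving _ _ _) (surviving _ _ _) => x y; nia.
have -> : \sum_(l < k | P l) m * m = m * (m * \sum_(l < k | P l) 1).
  by rewrite mulnA big_distrr /=; apply: eq_bigr => l _; rewrite muln1.
rewrite mulnBr leq_subLR => /leq_trans; apply.
by rewrite addnC leq_add2r leq_mul2l leq_add ?orbT.
Qed.

(** The first blocks of the diagonal meet an initial segment of the rows, so each
    of the top u rows removes m cells until these blocks are exhausted. *)
Lemma diagonal_initial m u k (P : pred nat) :
  (forall l, l.+1 < k -> P l.+1 -> P l) ->
  \sum_(l < k | P l) surviving m u l * surviving m 0 (k.-1 - l) =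
  m * (m * \sum_(l < k | P l) 1 - u).
Proof.
move=> down; under eq_bigr do rewrite surviving0.
by rewrite -big_distrl /= sum_initial // sum_surviving mulnC [_ * m]mulnC.
Qed.

(** Mirror image of [diagonal_initial]: the last blocks of the diagonal meet
    a final segment of the columns. *)
Lemma diagonal_final m j k (P : pred nat) :
  (forall l, l.+1 < k -> P l -> P l.+1) ->
  \sum_(l < k | P l) surviving m 0 l * surviving m j (k.-1 - l) =
  m * (m * \sum_(l < k | P l) 1 - j).
Proof.
move=> up.
rewrite [X in m * X - j](sum_rev k P (fun _ => 1)).
rewrite [LHS](sum_rev k P (fun l => surviving m 0 l * surviving m j (k.-1 - l))).
have down l : l.+1 < k -> P (k.-1 - l.+1) -> P (k.-1 - l).
  move=> lk; have -> : k.-1 - l = (k.-1 - l.+1).+1 by lia.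
  by apply: up; lia.
rewrite -[RHS](@diagonal_initial m j k (fun l => P (k.-1 - l)) down).
apply: eq_bigr => l _; rewrite !surviving0 mulnC; congr (surviving _ _ _ * _).
by have := ltn_ord l; lia.
Qed.

(** * Columns of block Ferrers diagrams *)

(** The factor of f b counts the columns before N in the b-th block column, as the
    difference of the numbers of columns before N and before either end. *)
Lemma sum_by_block m s N (f : nat -> nat) : 0 < m ->
  \sum_(x < s * m | x < N) f (x %/ m) =
  \sum_(b < s) (minn (b.+1 * m) N - minn (b * m) N) * f b.
Proof.
move=> m0; elim: s => [|s IH]; first by rewrite mul0n !big_ord0.
have le_sm : s * m <= s.+1 * m by rewrite leq_mul2r leqnSn orbT.
have cut (g : nat -> nat) : \sum_(x < s.+1 * m | x < N) g x =
    \sum_(x < s * m | x < N) g x + \sum_(s * m <= x < s.+1 * m | x < N) g x.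
  rewrite -(big_mkord (fun x => x < N) g) (big_cat_nat (leq0n (s * m)) le_sm) //=.
  by rewrite big_mkord.
rewrite (cut (fun x => f (x %/ m))) IH big_ord_recr /=; congr (_ + _).
have := cut (fun _ => 1); rewrite !sum_ord_lt => ->.
rewrite addKn big_distrl /= big_nat_cond [RHS]big_nat_cond.
apply: eq_bigr => x /andP[/andP[le_x lt_x] _].
by rewrite mul1n -(subnKC le_x) divnMDl // divn_small ?addn0 //; lia.
Qed.

Lemma card_initial_set n (A : {set 'I_n}) :
  (forall i i' : 'I_n, i = i'.+1 :> nat -> i \in A -> i' \in A) ->
  forall i, (i \in A) = (i < #|A|).
Proof.
move=> down i.
have down_le k (x y : 'I_n) : x = y + k :> nat -> x \in A -> y \in A.
  elim: k x => [|k IH] x e xA.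
    by have <- : x = y by apply/val_inj; rewrite /= e addn0.
  have h : y + k < n by rewrite (leq_trans _ (ltn_ord x)) // e addnS leqnSn.
  by apply: (IH (Ordinal h)) => //; apply: down xA; rewrite /= e addnS.
have card_lt k : k <= n -> #|[set y : 'I_n | y < k]| = k.
  by move=> kn; rewrite cardsE -sum1_card sum_ord_lt; apply/minn_idPr.
have [iA | niA] := boolP (i \in A).
  have : [set y : 'I_n | y < i.+1] \subset A.
    apply/subsetP => y; rewrite inE ltnS => yi.
    by apply: (down_le (i - y)) iA; rewrite subnKC.
  by move/subset_leq_card; rewrite card_lt.
have : A \subset [set y : 'I_n | y < i].
  apply/subsetP => y yA; rewrite inE ltnNge; apply: contra niA => iy.
  by apply: (down_le (y - i)) yA; rewrite subnKC.
by move/subset_leq_card; rewrite card_lt ?(ltnW (ltn_ord i)) // ltnNge => ->.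
Qed.

Lemma in_ferrers n (F : diagram n) (i j : 'I_n) :
  is_ferrers F -> ((i, j) \in F) = (i < colsize F j).
Proof.
case=> _ up; have := @card_initial_set n [set k | (k, j) \in F].
by move=> /(_ _ i) <- => [|x y]; rewrite !inE //; apply: up.
Qed.

Section BlockFerrers.

Variables (m s : nat) (F : diagram (s * m)).
Hypotheses (m_gt0 : 0 < m) (Fblock : is_block_ferrers F).

(** The column sizes of the contraction, indexed by natural numbers to avoid
    membership proofs in the sums along diagonals. *)
Definition height (b : nat) := #|[set l : 'I_s | block m s l b \subset F]|.

Lemma colsize_contraction (b : 'I_s) : colsize (contraction F) b = height b.
Proof. by apply: eq_card => l; rewrite !inE. Qed.

Lemma block_sub_height l b : l < s -> b < s ->
  (block m s l b \subset F) = (l < height b).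
Proof.
move=> ls bs; have C := contraction_is_ferrers m_gt0 Fblock.
have := in_ferrers (Ordinal ls) (Ordinal bs) C.
by rewrite colsize_contraction inE.
Qed.

Lemma height_le b : height b <= s.
Proof. by rewrite -[leqRHS]card_ord max_card. Qed.

Lemma in_block_ferrers (p : 'I_(s * m) * 'I_(s * m)) :
  (p \in F) = (p.1 %/ m < height (p.2 %/ m)).
Proof.
have lt (x : 'I_(s * m)) : x %/ m < s by rewrite ltn_divLR.
rewrite -block_sub_height //.
have pB : p \in block m s (p.1 %/ m) (p.2 %/ m) by rewrite in_block // !eqxx.
apply/idP/subsetP => [pF|]; last exact.
case: (Fblock) => _ /(_ (Ordinal (lt p.1)) (Ordinal (lt p.2))) /= [/setP/(_ p)|<-].
  by rewrite in_setI pB pF in_set0.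
by move=> x; rewrite in_setI => /andP[].
Qed.

Lemma colsize_block_ferrers x : colsize F x = height (x %/ m) * m.
Proof.
rewrite /colsize cardsE -sum1_card.
rewrite (eq_bigl (fun y : 'I_(s * m) => y < height (x %/ m) * m)); last first.
  by move=> y; rewrite -[LHS]/((y, x) \in F) in_block_ferrers /= ltn_divLR.
by rewrite sum_ord_lt; apply/minn_idPr; rewrite leq_mul2r height_le orbT.
Qed.

(** Columns are deleted from the right, hence the reversed column index. *)
Definition surviving_cells u j l b := surviving m u l * surviving m j (s.-1 - b).

(** * Deleting lines from a block Ferrers diagram *)

(** A term c + j.+1 - d of nu is c - (d.-1 - j): the column without its top
    d.-1 - j cells.  All columns of a block column have the same height, so the
    survivors of each block form a product. *)
Lemma nuE d j : j < d ->
  nu F d j = \sum_(b < s) \sum_(l < height b) surviving_cells (d.-1 - j) j l b.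
Proof.
move=> jd; rewrite /nu.
under eq_bigr => x _ do rewrite colsize_block_ferrers.
rewrite (@sum_by_block m s _ (fun b => height b * m + j.+1 - d)) //.
apply: eq_bigr => b _; rewrite -big_distrl /= sum_surviving mulnC.
congr (_ * _); first by lia.
case: b => b bs /=; rewrite /surviving.
have -> : s.-1 - b = s - b.+1 by lia.
rewrite -(subnKC bs) addKn; move: (s - b.+1) => t.
by rewrite mulnDl !mulSn; lia.
Qed.

Lemma card_block_diag i : i < s ->
  #|block_diag m s i.+1 :&: block_set F| =
  \sum_(l < i.+1 | l < height (s.-1 - i + l)) 1.
Proof.
move=> i_s; pose f (l : 'I_i.+1) := block m s l (s - i.+1 + l).
have bE (l : 'I_i.+1) : s - i.+1 + l = s.-1 - i + l by lia.
have lt1 (l : 'I_i.+1) : l < s by apply: leq_trans i_s.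
have lt2 (l : 'I_i.+1) : s - i.+1 + l < s by have := ltn_ord l; lia.
have -> : block_diag m s i.+1 :&: block_set F =
    [set f l | l : 'I_i.+1 & l < height (s.-1 - i + l)].
  apply/setP => B; apply/setIP/imsetP => [[/imsetP[l _ ->]] | [l + ->]].
    case/imsetP => -[l' b']; rewrite inE /= => sub e; exists l => //.
    by rewrite inE -bE -block_sub_height // e.
  rewrite inE -bE -block_sub_height // => sub; split; first exact: imset_f.
  by apply/imsetP; exists (Ordinal (lt1 l), Ordinal (lt2 l)); rewrite ?inE.
rewrite card_in_imset => [|l l' _ _ e].
  by rewrite cardsE -sum1_card.
have lt (k : 'I_s) : k * m < s * m by rewrite ltn_pmul2r.
(* The corner cell of a block determines l. *)
have := in_block l (s - i.+1 + l)
  (Ordinal (lt (Ordinal (lt1 l))), Ordinal (lt (Ordinal (lt2 l)))) m_gt0.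
rewrite -/(f l) e in_block //= !mulnK // !eqxx /= => /andP[/eqP h _].
exact/val_inj.
Qed.

(** The target value, with the cardinals of the block diagonals expressed by
    heights and diagonals indexed from 0. *)
Definition diagonal_sum d :=
  \sum_(i < s) m * (m * \sum_(l < i.+1 | l < height (s.-1 - i + l)) 1 - d.-1).

Lemma diagonal_sumE d : 0 < d ->
  m * \sum_(1 <= i < s.+1) (m * #|block_diag m s i :&: block_set F| + 1 - d) =
  diagonal_sum d.
Proof.
move=> d0; rewrite big_add1 /= big_mkord big_distrr /=.
by apply: eq_bigr => i _; rewrite card_block_diag //; congr (_ * _); lia.
Qed.

Lemma sum_surviving_cells_diagonals u j :
  \sum_(b < s) \sum_(l < b.+1 | l < height b) surviving_cells u j l b =
  \sum_(i < s) \sum_(l < i.+1 | l < height (s.-1 - i + l))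
     surviving m u l * surviving m j (i - l).
Proof.
under eq_bigr => b _ do rewrite big_mkcond /=.
rewrite (sum_triangle s (fun l b => if l < height b then surviving_cells u j l b else 0)).
apply: eq_bigr => i _; rewrite [RHS]big_mkcond; apply: eq_bigr => l _ /=.
case: ifP => // _; congr (_ * surviving _ _ _).
by have := ltn_ord l; have := ltn_ord i; lia.
Qed.

(** Blocks below the main diagonal are dropped; the others are regrouped by
    diagonals, where [diagonal_bound] applies with u + j = d - 1. *)
Lemma nu_ge d j : j < d -> diagonal_sum d <= nu F d j.
Proof.
move=> jd; rewrite nuE //.
have ju : d.-1 = d.-1 - j + j by lia.
apply: (@leq_trans (\sum_(i < s) \sum_(l < i.+1 | l < height (s.-1 - i + l))
                      surviving m (d.-1 - j) l * surviving m j (i - l))).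
  apply: leq_sum => i _; rewrite [X in _ - X]ju.
  exact: (diagonal_bound m _ j i.+1 (fun l => l < height (s.-1 - i + l))).
rewrite -sum_surviving_cells_diagonals; apply: leq_sum => b _.
case: (leqP (height b) b.+1) => hb.
  by rewrite (big_ord_widen _ (fun l => surviving_cells _ j l b) hb).
rewrite [leqRHS](bigID (fun l : 'I__ => l < b.+1)) /=.
rewrite -(big_ord_widen _ (fun l => surviving_cells _ j l b) (ltnW hb)) big_mkcond.
by apply: leq_trans (leq_addr _ _); apply: leq_sum => l _; case: ifP.
Qed.

(** For optimality nothing may be lost in [nu_ge], so every block has to lie on
    or above the main diagonal. *)
Lemma nu_upper_triangular d j : j < d -> (forall b, b < s -> height b <= b.+1) ->
  nu F d j =
  \sum_(i < s) \sum_(l < i.+1 | l < height (s.-1 - i + l))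
     surviving m (d.-1 - j) l * surviving m j (i - l).
Proof.
move=> jd le; rewrite nuE // -sum_surviving_cells_diagonals.
apply: eq_bigr => b _.
exact: (big_ord_widen _ (fun l => surviving_cells _ j l b) (le b (ltn_ord b))).
Qed.

(** As height b.+1 <= (height b).+1, the diagram contains with a block also the
    preceding block of its diagonal; with height 0 <= 1 it also follows that no
    block lies below the main diagonal. *)
Lemma nu_first_min d : 0 < d -> initially_block_convex F ->
  nu F d 0 = diagonal_sum d.
Proof.
move=> d0 [conv init].
have step b : b.+1 < s -> height b.+1 <= (height b).+1.
  move=> bs; have := conv (Ordinal (ltnW bs)) (Ordinal bs) erefl.
  by rewrite !colsize_contraction addn1.
have le b : b < s -> height b <= b.+1.
  elim: b => [|b IH] bs; first by rewrite -(colsize_contraction (Ordinal bs)) init.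
  by apply: leq_trans (step _ bs) _; rewrite ltnS IH // ltnW.
rewrite nu_upper_triangular // subn0; apply: eq_bigr => i _.
apply: (@diagonal_initial m d.-1 i.+1 (fun l => l < height (s.-1 - i + l))).
move=> l li; rewrite addnS => h; rewrite -ltnS; apply: leq_trans h (step _ _).
by have := ltn_ord i; lia.
Qed.

(** A block of the diagram lies in a nonempty block column, so the next column is
    higher and contains the next block of the diagonal.  Going back from the last
    column, of height at most s, the heights of nonempty columns lose at least 1
    at each step, so no block lies below the main diagonal. *)
Lemma nu_last_min d : 0 < d -> strictly_block_monotone F ->
  nu F d d.-1 = diagonal_sum d.
Proof.
move=> d0 mono.
have step b : b.+1 < s -> 0 < height b -> height b < height b.+1.
  move=> bs; have := mono (Ordinal (ltnW bs)) (Ordinal bs) erefl.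
  by rewrite !colsize_contraction.
have le b : b < s -> height b <= b.+1.
  move=> bs; have [k] := ubnP (s - b); elim: k b bs => // k IH b bs bk.
  have [bs' | sb] := ltnP b.+1 s; last by apply: leq_trans (height_le b) _.
  have [-> // | h] := posnP (height b).
  rewrite -ltnS; apply: leq_trans (step _ bs' h) (IH _ bs' _); lia.
rewrite nu_upper_triangular ?prednK // subnn; apply: eq_bigr => i _.
apply: (@diagonal_final m d.-1 i.+1 (fun l => l < height (s.-1 - i + l))).
move=> l li h; rewrite addnS; apply: leq_ltn_trans (h) (step _ _ _).
  by have := ltn_ord i; lia.
exact: leq_trans h.
Qed.

Lemma MSRD_constructible_of_nu d j : j < d -> nu F d j = diagonal_sum d ->
  MSRD_constructible F d.
Proof.
move=> jd attained; have d0 : 0 < d by apply: leq_ltn_trans jd.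
rewrite /MSRD_constructible diagonal_sumE //; apply/eqP; rewrite eqn_leq.
apply/andP; split.
  rewrite -attained.
  exact: (bigmin_leq _ (fun k : 'I_d => nu F d k) (mem_index_enum (Ordinal jd))).
apply: (big_ind (leq (diagonal_sum d))) => [|x y|k _].
- exact: nu_ge.
- by rewrite leq_min => ->.
- exact: nu_ge.
Qed.

Lemma block_MSRD_constructible d : 0 < d ->
  strictly_block_monotone F \/ initially_block_convex F ->
  MSRD_constructible F d.
Proof.
move=> d0 [mono | conv]; last exact: MSRD_constructible_of_nu (nu_first_min d0 conv).
by apply: MSRD_constructible_of_nu (nu_last_min d0 mono); rewrite prednK.
Qed.

End BlockFerrers.

Lemma block_triangular_strictly_monotone m s : 0 < m ->
  strictly_block_monotone (block_triangular m s).
Proof.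
move=> m0.
have lt (k : 'I_s) : k * m < s * m by rewrite ltn_pmul2r.
have inC (l b : 'I_s) :
    ((l, b) \in contraction (block_triangular m s)) = (l <= b).
  rewrite inE /=; apply/subsetP/idP => [/(_ (Ordinal (lt l), Ordinal (lt b)))|le p].
    by rewrite in_block ?in_block_triangular //= !mulnK // !eqxx => /(_ isT).
  by rewrite in_block ?in_block_triangular // => /andP[/eqP -> /eqP ->].
have hC (b : 'I_s) : colsize (contraction (block_triangular m s)) b = b.+1.
  rewrite /colsize cardsE -sum1_card (eq_bigl (fun l : 'I_s => l < b.+1)).
    by rewrite sum_ord_lt; apply/minn_idPr.
  by move=> l; rewrite -[LHS]/((l, b) \in contraction _) inC ltnS.
by move=> b b' e _; rewrite !hC e.
Qed.

Theorem corollary4p28 (m s : nat) (hm : 0 < m) (hs : 0 < s) :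
  (forall F : {set 'I_(s * m) * 'I_(s * m)},
     is_block_ferrers F ->
     strictly_block_monotone F \/ initially_block_convex F ->
     forall d : nat, 2 <= d <= s * m -> MSRD_constructible F d) /\
  (forall d : nat, 1 <= d <= s * m ->
     MSRD_constructible (block_triangular m s) d).
Proof.
split=> [F Fblock shape d /andP[d2 _] | d /andP[d1 _]].
  by apply: block_MSRD_constructible => //; apply: ltnW.
apply: block_MSRD_constructible => //; first exact: block_triangular_is_block_ferrers.
by left; apply: block_triangular_strictly_monotone.
Qed.
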